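(* Let $d\in\mathbb{N}$, $s,\alpha,\beta,\gamma,\theta\in\mathbb{R}$, and $p,q\in(0,\infty]$. Assume that $a$ follows a Besov sequence prior with parameters $(\alpha,\beta,\gamma,\theta)$ and template random variable $X$ satisfying $\mathbb{P}(X\neq0)>0$. If $a\in b^s_{p,q}(\mathbb{R}^d)$ almost surely, then Property A is satisfied.
   Context: Notation: $\mathbb{N}=\{1,2,\dots\}$, $\mathbb{N}_0=\mathbb{N}\cup\{0\}$, $d/\infty=1/\infty=0$. $F,M$ are two symbols; $T_0=\{F\}^d$, $T_j=\{F,M\}^d\setminus T_0$ for $j\in\mathbb{N}$, and $J=\{(j,t,m): j\in\mathbb{N}_0, t\in T_j, m\in\mathbb{Z}^d\}$. $\|\cdot\|_{\ell_p}$ is the usual (quasi-)norm (supremum if $p=\infty$), and $\mathbf 1_{j=0}$ is $1$ if $j=0$ and $0$ otherwise. Besov sequence space: $b^s_{p,q}(\mathbb{R}^d)$ is the set of $a=(a_{j,t,m})_{(j,t,m)\in J}\in\mathbb{R}^J$ with $\|a\|_{b^s_{p,q}(\mathbb{R}^d)}:=\big\|\big(2^{j(s+\frac d2-\frac dp)}\|(a_{j,t,m})_{m\in\mathbb{Z}^d}\|_{\ell_p}\big)_{j\in\mathbb{N}_0,t\in T_j}\big\|_{\ell_q}<\infty$. Besov sequence prior: $a=(a_{j,t,m})_{(j,t,m)\in J}$ follows a Besov sequence prior with parameters $(\alpha,\beta,\gamma,\theta)$ and (real-valued) template random variable $X$ if there are i.i.d. random variables $\xi_{j,t,m}\sim X$,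 $(j,t,m)\in\mathbb{N}_0\times\{F,M\}^d\times\mathbb{Z}^d$, with $a_{j,t,m}=2^{j\alpha}(j+1)^\theta\big(1+\frac{\|m\|_\infty}{2^j}\big)^{\beta+(\gamma-\beta)\mathbf 1_{j=0}}\xi_{j,t,m}$. Property A (for $d,s,p,q,\alpha,\beta,\gamma,\theta$): either ($\gamma<-\frac dp$, $\beta<-\frac dp$, $s+\frac d2+\alpha<0$) or ($\gamma<-\frac dp$, $\beta<-\frac dp$, $s+\frac d2+\alpha=0$, $\theta<-\frac1q$). When $p=\infty$, the conditions $\gamma<-\frac dp$, $\beta<-\frac dp$ are replaced by $\gamma\le0$, $\beta\le0$; when $q=\infty$, the condition $\theta<-\frac1q$ is replaced by $\theta\le0$. *)

(* Defs.v *)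
From HB Require Import structures.
From mathcomp Require Import all_boot all_order all_algebra finmap.
From mathcomp Require Import all_classical all_reals all_analysis.

Set Implicit Arguments.
Unset Strict Implicit.
Unset Printing Implicit Defensive.

Import Order.TTheory GRing.Theory Num.Theory.

Local Open Scope classical_set_scope.
Local Open Scope ring_scope.

(** * Index sets *)

Inductive symbol := F | M.

Definition symbol_to_bool (x : symbol) := if x is M then true else false.
Definition symbol_of_bool (b : bool) := if b then M else F.

Lemma symbol_to_boolK : cancel symbol_to_bool symbol_of_bool.
Proof. by case. Qed.

HB.instance Definition _ := Finite.copy symbol (can_type symbol_to_boolK).

Definition symbols (d : nat) : Type := {ffun 'I_d -> symbol}.
HB.instance Definition _ d := Finite.on (symbols d).

Definition Zlattice (d : nat) : Type := {ffun 'I_d -> int}.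
HB.instance Definition _ d := Choice.on (Zlattice d).

(** [level_types d j] is the set T_j. *)
Definition level_types (d j : nat) : {set symbols d} :=
  if j == 0%N then [set [ffun=> F]]%SET else (~: [set [ffun=> F]])%SET.

(** The pairs (j, t) with t in T_j; [level] and [ftype] are the components. *)
Definition scale (d : nat) : Type :=
  {jt : nat * symbols d | jt.2 \in level_types d jt.1}.
HB.instance Definition _ d := Choice.on (scale d).

Definition level (d : nat) (k : scale d) : nat := (val k).1.
Definition ftype (d : nat) (k : scale d) : symbols d := (val k).2.

(** The index set J; an element of R^J is a function [J d -> R]. *)
Definition J (d : nat) : Type := (scale d * Zlattice d)%type.

Definition supnorm (d : nat) (m : Zlattice d) : nat := \max_(i < d) `|m i|%N.

(** * Sequence norms *)

(** 1/p as a real number, with 1/oo = 0. *)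
Definition rinv (R : realType) (p : \bar R) : R := fine (p^-1)%E.

(** The l_p (quasi-)norm over an arbitrary index set, for 0 < p <= oo. Entries
    are extended reals since an inner norm can be infinite in a mixed norm. *)
Definition lp_norm (R : realType) (I : choiceType) (p : \bar R)
    (x : I -> \bar R) : \bar R :=
  match p with
  | r%:E => ((\esum_(i in [set: I]) (`|x i| `^ r)) `^ r^-1)%E
  | +oo%E => ereal_sup (range (fun i => `|x i|%E))
  | -oo%E => 0%E (* junk value *)
  end.

Definition besov_norm (R : realType) (d : nat) (s : R) (p q : \bar R)
    (a : J d -> R) : \bar R :=
  lp_norm q (fun k : scale d =>
    (2 `^ ((level k)%:R * (s + d%:R / 2 - d%:R * rinv p)))%:E *
    lp_norm p (fun m : Zlattice d => (a (k, m))%:E))%E.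

Definition besov_space (R : realType) (d : nat) (s : R) (p q : \bar R) :
    set (J d -> R) :=
  [set a | (besov_norm s p q a < +oo)%E].

(** * Besov sequence priors *)

Definition mutually_independent (R : realType) (disp : measure_display)
    (Omega : measurableType disp) (P : probability Omega R) (I : choiceType)
    (xi : I -> {RV P >-> R}) : Prop :=
  forall (A : {fset I}) (B : I -> set R),
    (forall i, measurable (B i)) ->
    P (\bigcap_(i in [set` A]) (xi i @^-1` B i)) =
    (\big[*%E/1%E]_(i <- A) P (xi i @^-1` B i))%E.

(** Equality of laws is only required on measurable sets: [distribution] takes
    irrelevant values elsewhere. *)
Definition same_distribution (R : realType) (disp disp' : measure_display)
    (Omega : measurableType disp) (P : probability Omega R)
    (Omega' : measurableType disp') (P' : probability Omega' R)
    (Y : {RV P >-> R}) (X : {RV P' >-> R}) : Prop :=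
  forall B : set R, measurable B -> distribution P Y B = distribution P' X B.

Definition prior_weight (R : realType) (d : nat) (alpha beta gamma theta : R)
    (j : nat) (m : Zlattice d) : R :=
  2 `^ (j%:R * alpha) * (j.+1%:R) `^ theta *
  (1 + (supnorm m)%:R / 2 ^+ j) `^ (beta + (gamma - beta) * (j == 0%N)%:R).

(** The template X may live on a probability space of its own. The family xi is
    indexed by all (j, t, m), including those with t outside T_j. *)
Definition besov_sequence_prior (R : realType) (d : nat)
    (alpha beta gamma theta : R) (disp disp' : measure_display)
    (Omega : measurableType disp) (P : probability Omega R)
    (Omega' : measurableType disp') (P' : probability Omega' R)
    (X : {RV P' >-> R}) (a : J d -> Omega -> R) : Prop :=
  exists xi : (nat * symbols d * Zlattice d)%type -> {RV P >-> R},
    [/\ mutually_independent xi,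
        forall i, same_distribution (xi i) X &
        forall (k : scale d) (m : Zlattice d) (w : Omega),
          a (k, m) w = prior_weight alpha beta gamma theta (level k) m *
                       xi (level k, ftype k, m) w].

(** * Property A *)

Definition propertyA (R : realType) (d : nat) (s : R) (p q : \bar R)
    (alpha beta gamma theta : R) : Prop :=
  let below_dp (x : R) : Prop :=
    if p == +oo%E then x <= 0 else x < - (d%:R * rinv p) in
  let below_1q (x : R) : Prop :=
    if q == +oo%E then x <= 0 else x < - rinv q in
  [/\ below_dp gamma, below_dp beta & s + d%:R / 2 + alpha < 0] \/
  [/\ below_dp gamma, below_dp beta, s + d%:R / 2 + alpha = 0 &
      below_1q theta].

(* Main.v *)
Require Import Defs.
From mathcomp Require Import all_boot all_order all_algebra.
From mathcomp Require Import all_classical all_reals all_analysis.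
From mathcomp Require Import measurable_realfun ring lra.

Import Order.TTheory GRing.Theory Num.Theory.

Local Open Scope classical_set_scope.
Local Open Scope ring_scope.

(** The proof replaces the random sequence by its deterministic weights and then
reads off Property A from the finiteness of the Besov norm of the weights.

Since X is not almost surely 0, there are e, c > 0 such that each of the
equidistributed variables xi_i satisfies |xi_i| >= e on an event A_i of
probability at least c. For weights u_i >= 0, the sum over i of u_i^p 1_{A_i}
has expectation at least c times its maximal value sum_i u_i^p, so by a reverse
Markov inequality it is at least c / 2 times that value with probability at
least c / 2. Thus for every y below the l_p norm of u, the l_p norm of a
sequence that dominates e u_i on A_i is at least a constant multiple of y with
probability at least c / 2 ([lp_norm_ge_prob]), where neither the constant nor
c / 2 depends on y. If the norm of u were infinite, the random norm would exceed
every integer n on an event of probability at least c / 2, hence be infinite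
with positive probability ([ae_finite_unlikely]). As the events produced for the
inner norms again have probability bounded below, the same argument applies to
the outer l_q norm, and the weights lie in b^s_{p,q} ([besov_space_ae]).

For the weights, everything follows from one divergence criterion
([lp_norm_growth]): if for every N there are N^D indices of rank in [N, 2N), and
the entries there are at least k (1 + rank)^delta, then a finite l_p norm forces
delta < -D/p (delta <= 0 for p = oo). With the lattice shells [N, 2N)^d and the
sup norm as rank, levels 0 and 1 give the conditions on gamma and beta. For the
outer norm, bounding the inner norm from below by the shell with N = 2^j shows
that the entries at level j are at least a multiple of
2^(j sigma) (j + 1)^theta with sigma = s + d/2 + alpha. The criterion with D = 1
and rank j excludes sigma > 0 (compare with delta = 1) and gives the condition
on theta when sigma = 0 (delta = theta). *)

(** * Sequence norms *)

Section Norms.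
Context {R : realType} {I : choiceType}.
Implicit Types (p : \bar R) (x f : I -> \bar R) (r : seq I).

Lemma esum_ge_seq f r : (forall i, 0 <= f i)%E -> uniq r ->
  (\sum_(i <- r) f i <= \esum_(i in [set: I]) f i)%E.
Proof.
move=> f0 ur; apply: esum_ge; exists [set` r].
  by split => //; exact: finite_seq.
by rewrite fsbig_seq.
Qed.

Lemma esum_gt_seq f (y : \bar R) : (y < \esum_(i in [set: I]) f i)%E ->
  exists2 r, uniq r & (y < \sum_(i <- r) f i)%E.
Proof.
move=> /ereal_sup_gt[_ [A [finA _] <-] yA].
exists (finmap.enum_fset (fset_set A)); first exact: finmap.fset_uniq.
by rewrite -fsbig_finite.
Qed.

(** A Cauchy criterion: a finite set whose sum is within e of a finite total
leaves no room for a disjoint finite set of sum at least e. *)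
Lemma esum_gap f (e : R) : (forall i, 0 <= f i)%E -> 0 < e ->
  (forall r, exists2 r', uniq r' & {in r', forall i, i \notin r} /\
     (e%:E <= \sum_(i <- r') f i)%E) ->
  (\esum_(i in [set: I]) f i = +oo)%E.
Proof.
move=> f0 e0 gap; apply/eqP; apply/negP => /negP esum_fin.
set S := (\esum_(i in _) _)%E in esum_fin.
have S0 : (0 <= S)%E by exact: esum_ge0.
have [s Ss] : exists s, S = s%:E.
  by case: S S0 esum_fin => // s _ _; exists s.
have [r ur rS] : exists2 r, uniq r & ((s - e)%:E < \sum_(i <- r) f i)%E.
  by apply: esum_gt_seq; rewrite -/S Ss lte_fin ltrBlDr ltrDl.
have [r' ur' [rr' er']] := gap r.
have : (\sum_(i <- r ++ r') f i <= S)%E.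
  apply: esum_ge_seq => //; rewrite cat_uniq ur ur' andbT /=.
  by apply/hasPn => i /rr'.
rewrite big_cat /= Ss leNgt => /negP; apply.
have -> : s%:E = ((s - e)%:E + e%:E)%E by rewrite -EFinD subrK.
by apply: lte_leD.
Qed.

Lemma le_poweR_inv (r y : R) (S : \bar R) : 0 < r -> 0 <= y -> (0 <= S)%E ->
  (y%:E <= S `^ r^-1)%E = ((y `^ r)%:E <= S)%E.
Proof.
move=> r0 y0; case: S => // [s|_]; last first.
  by rewrite poweRyr ?invr_eq0 ?gt_eqF// !leey.
rewrite lee_fin => s0; rewrite poweR_EFin !lee_fin.
have ynneg : y \in Num.nneg by [].
have ssr : s = (s `^ r^-1) `^ r by rewrite -powRrM mulVf ?gt_eqF// powRr1.
rewrite [in RHS]ssr; apply/idP/idP => [|].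
  by apply: ge0_ler_powR; rewrite ?ltW// ?nnegrE ?powR_ge0.
apply: contraTT; rewrite -!ltNge.
by apply: gt0_ltr_powR; rewrite ?nnegrE ?powR_ge0.
Qed.

Lemma rinv_EFin (r : R) : 0 < r -> rinv r%:E = r^-1.
Proof. by move=> r0; rewrite /rinv inver gt_eqF. Qed.

Lemma rinv_pinfty : rinv +oo%E = 0 :> R.
Proof. by rewrite /rinv invey. Qed.

Lemma lp_norm_EFin (r : R) x :
  lp_norm r%:E x = ((\esum_(i in [set: I]) `|x i| `^ r) `^ r^-1)%E.
Proof. by []. Qed.

Lemma lp_norm_ge_entry p x i : (0 < p)%E -> (`|x i| <= lp_norm p x)%E.
Proof.
case: p => [r| |] //=; last by move=> _; apply: ereal_sup_ubound; exists i.
rewrite lte_fin => r0.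
have -> : (`|x i| = (`|x i| `^ r) `^ r^-1)%E.
  by rewrite -poweRrM mulfV ?gt_eqF// poweRe1.
have g0 j : (0 <= `|x j| `^ r)%E by exact: poweR_ge0.
apply: gt0_ler_poweR; rewrite ?invr_ge0 ?(ltW r0)// ?in_itv/= ?leey ?andbT//.
  by apply: esum_ge0 => *.
have := @esum_ge_seq (fun j => `|x j| `^ r)%E [:: i] g0 isT.
by rewrite big_seq1.
Qed.

Lemma lp_norm_ge_seq p x r (u : R) : (0 < p)%E -> uniq r -> r != [::] ->
  0 <= u -> {in r, forall i, u%:E <= `|x i|}%E ->
  ((u * (size r)%:R `^ rinv p)%:E <= lp_norm p x)%E.
Proof.
case: p => [p| |] //=; last first.
  move=> _ ur; case: r ur => // i r _ _ u0 /(_ i (mem_head _ _)) ui.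
  rewrite rinv_pinfty powRr0 mulr1; apply: le_trans ui _.
  exact: (@lp_norm_ge_entry +oo%E).
rewrite lte_fin => p0 ur _ u0 ux; rewrite rinv_EFin//.
have g0 j : (0 <= `|x j| `^ p)%E by exact: poweR_ge0.
rewrite le_poweR_inv// ?mulr_ge0 ?powR_ge0//; last by apply: esum_ge0.
rewrite powRM ?powR_ge0// -powRrM mulVf ?gt_eqF// powRr1//.
apply: le_trans (esum_ge_seq _ _ g0 ur).
rewrite mulr_natr.
have -> : u `^ p *+ size r = \sum_(i <- r) u `^ p.
  by rewrite big_const_seq count_predT iter_addr addr0.
rewrite -sumEFin big_seq [leRHS]big_seq; apply: lee_sum => i ir.
rewrite -poweR_EFin; apply: gt0_ler_poweR; rewrite ?(ltW p0) ?ux//.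
  by rewrite in_itv/= lee_fin u0 leey.
by rewrite in_itv/= leey abse_ge0.
Qed.

(** An index set of dimension D with respect to a rank: there are N^D indices
with rank in the dyadic range [N, 2N), the order of magnitude of the number of
points of Z^D whose sup norm lies in that range. *)
Definition shells (D : nat) (rank : I -> nat) (shell : nat -> seq I) : Prop :=
  forall N, (0 < N)%N -> [/\ uniq (shell N), size (shell N) = (N ^ D)%N &
    {in shell N, forall i, (N <= rank i < N.*2)%N}].

(** For p = oo the entries on the shells are unbounded as soon as delta > 0. For
finite p with delta p >= -D, the N^D terms on a shell, of size at least
k^p (2N)^(-D) each, sum to at least k^p 2^(-D), and shells with N above
the ranks in a given finite set are disjoint from it. *)
Lemma lp_norm_growth p (D : nat) rank shell x (k delta : R) : (0 < p)%E ->
  shells D rank shell -> 0 < k ->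
  (forall N, (0 < N)%N -> {in shell N, forall i,
     (k * (1 + (rank i)%:R) `^ delta)%:E <= `|x i|})%E ->
  (lp_norm p x < +oo)%E ->
  if p == +oo%E then delta <= 0 else delta < - (D%:R * rinv p).
Proof.
move=> + shellP k0 xge.
case: p => [p| |]// p0; last first.
  rewrite eqxx => xfin; rewrite leNgt; apply/negP => d0.
  have shell_mem N : (0 < N)%N -> exists i, i \in shell N.
    move=> N0; have [_ sz _] := shellP _ N0.
    case: (shell N) sz => [|i s] sz; last by exists i; rewrite mem_head.
    by move: sz => /= /esym/eqP; rewrite expn_eq0; case: N N0.
  have [L E] : exists L, lp_norm +oo%E x = L%:E.
    have [i _] := shell_mem 1%N isT.
    have := lp_norm_ge_entry _ x i p0.
    case: (lp_norm _ _) xfin => [L _ _| //|_]; first by exists L.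
    by rewrite leNgt (lt_le_trans _ (abse_ge0 _))// ltNyr.
  have bnd N : (0 < N)%N -> k * N%:R `^ delta <= L.
    move=> N0; have [_ _ rk] := shellP _ N0.
    have [i iN] := shell_mem _ N0.
    rewrite -lee_fin -E; apply: le_trans (lp_norm_ge_entry _ x i p0).
    apply: le_trans (xge _ N0 _ iN); rewrite lee_fin ler_pM2l//.
    apply: ge0_ler_powR; rewrite ?(ltW d0) ?nnegrE//.
    have /andP[Ni _] := rk _ iN.
    by rewrite -(ler_nat R) in Ni; lra.
  (* y solves k y^delta = |L| + k, so any integer beyond y violates bnd. *)
  set y := (`|L| / k + 1) `^ delta^-1.
  have := bnd (Num.truncn y).+1 isT.
  have yN : y <= (Num.truncn y).+1%:R by rewrite ltW// truncnS_gt.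
  apply/negP; rewrite -ltNge.
  have Ly : `|L| + k = k * y `^ delta.
    rewrite /y -powRrM mulVf ?gt_eqF// powRr1; last by rewrite addr_ge0 ?divr_ge0// ltW.
    by field; rewrite gt_eqF.
  apply: (@lt_le_trans _ _ (k * y `^ delta)).
    by rewrite -Ly; have := ler_norm L; lra.
  rewrite ler_pM2l//; apply: ge0_ler_powR; rewrite ?(ltW d0)// ?nnegrE//.
    exact: powR_ge0.
rewrite lte_fin in p0.
have pE : (p%:E == +oo%E :> \bar R) = false by [].
rewrite pE rinv_EFin// => xfin; rewrite ltNge; apply/negP => dge.
have dp : - D%:R <= delta * p by move: dge; rewrite -mulNr ler_pdivrMr.
move: xfin => /=; rewrite (@esum_gap (fun i => `|x i| `^ p)%E (k `^ p * 2 `^ (- D%:R))).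
- by rewrite poweRyr ?ltxx// invr_eq0 gt_eqF.
- by move=> i; exact: poweR_ge0.
- by rewrite mulr_gt0 ?powR_gt0.
move=> r; pose N := (\max_(i <- r) rank i).+1.
have [us sz rk] := shellP N isT; exists (shell N) => //; split.
  move=> i /rk/andP[Ni _]; apply/negP => ir.
  by have := @leq_bigmax_seq _ r predT rank i ir isT; rewrite leqNgt Ni.
have N0 : 0 < N%:R :> R by rewrite ltr0n.
have -> : k `^ p * 2 `^ (- D%:R) = \sum_(i <- shell N) (k `^ p * (N.*2)%:R `^ (- D%:R)).
  rewrite big_const_seq count_predT iter_addr addr0 sz -[RHS]mulr_natr natrX -mulrA.
  congr (_ * _); rewrite -muln2 natrM powRM// mulrAC [N%:R `^ _]powR_invn// mulVf ?mul1r//.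
  by rewrite expf_neq0 ?gt_eqF.
rewrite -sumEFin big_seq [leRHS]big_seq; apply: lee_sum => i iN.
have /andP[Ni iN2] := rk i iN.
have e0 : 0 <= k * (1 + (rank i)%:R) `^ delta by rewrite mulr_ge0 ?ltW ?powR_gt0//; lra.
apply: (@le_trans _ _ ((k * (1 + (rank i)%:R) `^ delta)%:E `^ p)%E); last first.
  apply: gt0_ler_poweR; rewrite ?(ltW p0)// ?in_itv/= ?leey ?abse_ge0 ?andbT ?lee_fin//.
  exact: xge iN.
rewrite poweR_EFin lee_fin powRM ?(ltW k0) ?powR_ge0//.
rewrite ler_pM2l ?powR_gt0// -powRrM.
have r1 : 1 <= 1 + (rank i)%:R :> R by rewrite lerDl.
apply: (@le_trans _ _ ((1 + (rank i)%:R) `^ (- D%:R))); last by apply: ler_powR.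
have r0 : 0 < 1 + (rank i)%:R :> R by exact: lt_le_trans ltr01 r1.
have N20 : 0 < N.*2%:R :> R by rewrite ltr0n double_gt0.
rewrite !powRN lef_pV2 ?posrE ?powR_gt0//.
apply: ge0_ler_powR; rewrite ?nnegrE ?(ltW r0) ?(ltW N20)//.
by rewrite -(natrD _ 1) ler_nat add1n.
Qed.

End Norms.

(** * Random sequences *)

Section Probability.
Context {R : realType} {disp : measure_display} {Omega : measurableType disp}.
Variable P : probability Omega R.

(** The random sum f is at most S = sum_i u_i and has expectation at least c S;
integrating f <= S 1_B + (c / 2) S, where B = {f >= (c / 2) S}, bounds P B from
below. *)
Lemma reverse_markov (I : Type) (r : seq I) (u : I -> R)
    (A : I -> set Omega) (c : R) :
  0 < c -> (forall i, 0 <= u i) -> 0 < \sum_(i <- r) u i ->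
  (forall i, measurable (A i)) -> (forall i, c%:E <= P (A i))%E ->
  exists B, [/\ measurable B, ((c / 2)%:E <= P B)%E & forall w, B w ->
     c / 2 * \sum_(i <- r) u i <= \sum_(i <- r) u i * \1_(A i) w].
Proof.
move=> c0 u0; set S := \sum_(i <- r) u i => S0 mA cA.
pose f (w : Omega) := \sum_(i <- r) u i * \1_(A i) w : R.
have mf : measurable_fun setT f.
  by apply: measurable_sum => i; apply: measurable_funM => //; exact: measurable_indic.
have f0 w : 0 <= f w.
  by apply: sumr_ge0 => i _; rewrite mulr_ge0// indicE.
have fS w : f w <= S.
  by apply: ler_sum => i _; rewrite ler_piMr// indicE lern1; case: (_ \in _).
pose B := f @^-1` `[c / 2 * S, +oo[.
have mB : measurable B by rewrite -[B]setTI; apply: mf.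
exists B; split => //; last by move=> w; rewrite /B/= in_itv/= andbT.
have lower : ((c * S)%:E <= \int[P]_w (f w)%:E)%E.
  under eq_integral do rewrite -sumEFin.
  rewrite ge0_integral_sum//; last 2 first.
    move=> i; apply/measurable_EFinP; apply: measurable_funM => //.
    by move=> i w _; rewrite lee_fin mulr_ge0// indicE.
  rewrite /S mulr_sumr -sumEFin; apply: lee_sum => i _.
  under eq_integral do rewrite EFinM.
  rewrite ge0_integralZl_EFin//; last first.
    by apply/measurable_EFinP; exact: measurable_indic.
  rewrite integral_indic// setIT mulrC EFinM; apply: lee_wpmul2l => //.
    by rewrite lee_fin.
  exact: cA.
have upper : (\int[P]_w (f w)%:E <= S%:E * P B + (c / 2 * S)%:E)%E.
  have cS0 : 0 <= c / 2 * S by rewrite mulr_ge0 ?divr_ge0// ltW.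
  have mB1 : measurable_fun setT (fun w => (\1_B w)%:E : \bar R).
    by apply/measurable_EFinP; exact: measurable_indic.
  apply: (@le_trans _ _ (\int[P]_w (S%:E * (\1_B w)%:E + (c / 2 * S)%:E))%E).
    apply: ge0_le_integral => //.
    - by move=> w _; rewrite lee_fin.
    - exact/measurable_EFinP.
    - by apply: emeasurable_funD => //; apply: measurable_funeM.
    move=> w _; rewrite lee_fin indicE; have [/set_mem Bw|] := boolP (w \in B).
      by rewrite mulr1 (le_trans (fS w))// lerDl.
    move=> /negP Bw; rewrite mulr0 add0r leNgt; apply/negP => /ltW h; apply: Bw.
    by rewrite inE /B/= in_itv/= h.
  rewrite ge0_integralD//; last 2 first.
  - by move=> w _; rewrite mule_ge0// lee_fin// ltW.
  - exact: measurable_funeM.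
  rewrite ge0_integralZl_EFin ?(ltW S0)// integral_indic// setIT.
  rewrite integral_cst//; apply: leeD => //; rewrite -[leRHS]mule1.
  by apply: lee_wpmul2l; [rewrite lee_fin | exact: probability_le1].
have [b Pb] : exists b, P B = b%:E.
  by exists (fine (P B)); rewrite fineK// fin_num_measure.
have := le_trans lower upper; rewrite Pb -EFinM -EFinD !lee_fin => h.
by rewrite -(ler_pM2l S0); lra.
Qed.

(** On the limit superior of the B n the function f is infinite, and its
probability is at least c by continuity from above, since each union of the
B k with k >= n has probability at least c. *)
Lemma ae_finite_unlikely (f : Omega -> \bar R) (c : R) (B : nat -> set Omega) :
  0 < c -> (forall n, measurable (B n)) -> (forall n, c%:E <= P (B n))%E ->
  (forall n w, B n w -> n%:R%:E <= f w)%E ->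
  ~ {ae P, forall w, (f w < +oo)%E}.
Proof.
move=> c0 mB cB Bf [N [mN N0 fN]].
have : (c%:E <= P (lim_sup_set B))%E.
  have mU n : measurable (\bigcup_(k >= n) B k).
    by apply: bigcup_measurable => k _.
  have U_fin : (P (\bigcup_(k >= 0%N) B k) < +oo)%E.
    by rewrite (le_lt_trans (probability_le1 P (mU 0%N)))// ltry.
  have Bcvg := lim_sup_set_cvg P B mB U_fin.
  rewrite -(cvg_lim _ Bcvg)//; apply: lime_ge; first by apply/cvg_ex; eexists; exact: Bcvg.
  apply: nearW => n; apply: le_trans (cB n) _; apply: le_measure; rewrite ?inE//.
  by move=> w Bw; exists n => /=.
apply/negP; rewrite -ltNge; apply: le_lt_trans (_ : 0%E < _)%E; rewrite ?lte_fin//.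
rewrite -N0; apply: le_measure; rewrite ?inE//.
  apply: bigcap_measurable => // n _; apply: bigcup_measurable => k _; exact: mB.
apply: subset_trans fN => w Bw /=; apply/negP; rewrite -leNgt leye_eq.
apply/eqP/eqyP => t t0.
have [k /= tk Bk] := Bw (Num.truncn t).+1 I.
apply: le_trans (Bf k w Bk); rewrite lee_fin ltW//.
by rewrite (lt_le_trans (truncnS_gt _))// ler_nat.
Qed.

(** For finite p, a finite subset of the indices already carries more than y^p,
and the reverse Markov inequality applies to it; for p = oo a single index does.
The level y, rather than the norm of u itself, lets the latter be infinite. *)
Lemma lp_norm_ge_prob (I : choiceType) (p : \bar R) (c e y : R) (u : I -> R)
    (A : I -> set Omega) (x : I -> Omega -> \bar R) :
  (0 < p)%E -> 0 < c -> 0 <= e ->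
  (forall i, measurable (A i)) -> (forall i, c%:E <= P (A i))%E ->
  (forall i, 0 <= u i) ->
  (forall i w, A i w -> (e * u i)%:E <= `|x i w|)%E ->
  0 <= y -> (y%:E < lp_norm p (fun i => (u i)%:E))%E ->
  exists B, [/\ measurable B, ((c / 2)%:E <= P B)%E & forall w, B w ->
    ((e * (c / 2) `^ rinv p * y)%:E <= lp_norm p (fun i => x i w))%E].
Proof.
move=> + c0 e0 mA cA u0 ux y0; have c20 : 0 < c / 2 by rewrite divr_gt0.
case: p => [p| |]// p0; last first.
  move=> /ereal_sup_gt[_ [i _ <-]]; rewrite abse_EFin ger0_norm// lte_fin => yu.
  exists (A i); split => //.
    by apply: le_trans (cA i); rewrite lee_fin; lra.
  move=> w Aw; rewrite rinv_pinfty powRr0 mulr1.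
  apply: le_trans (lp_norm_ge_entry _ _ i p0); apply: le_trans (ux _ _ Aw).
  by rewrite lee_fin ler_wpM2l// ltW.
rewrite lte_fin in p0; rewrite lp_norm_EFin; set S := esum _ _ => yS.
have {yS} : ((y `^ p)%:E < S)%E.
  rewrite ltNge; apply: contraTN yS => yS; rewrite -leNgt.
  have -> : y%:E = ((y `^ p)%:E `^ p^-1)%E.
    by rewrite poweR_EFin -powRrM mulfV ?gt_eqF// powRr1.
  apply: gt0_ler_poweR; rewrite ?invr_ge0 ?(ltW p0)// in_itv/= leey andbT.
    by apply: esum_ge0 => *; exact: poweR_ge0.
  by rewrite lee_fin powR_ge0.
move=> /esum_gt_seq[r ur].
have -> : (\sum_(i <- r) `|(u i)%:E| `^ p)%E = (\sum_(i <- r) u i `^ p)%:E.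
  by rewrite -sumEFin; apply: eq_bigr => i _; rewrite abse_EFin ger0_norm.
rewrite lte_fin => yr.
have up0 i : 0 <= u i `^ p by exact: powR_ge0.
have [B [mB cB Bf]] :=
  reverse_markov _ _ _ _ _ c0 up0 (le_lt_trans (powR_ge0 _ _) yr) mA cA.
exists B; split => // w Bw.
have xp0 i : (0 <= `|x i w| `^ p)%E by exact: poweR_ge0.
rewrite rinv_EFin// lp_norm_EFin le_poweR_inv ?mulr_ge0 ?powR_ge0 ?esum_ge0//.
apply: le_trans (esum_ge_seq _ _ xp0 ur).
set t := (c / 2) `^ p^-1; have t0 : 0 <= t by exact: powR_ge0.
have tp : t `^ p = c / 2 by rewrite -powRrM mulVf ?gt_eqF// powRr1 ?ltW.
rewrite !powRM ?mulr_ge0// tp.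
apply: (@le_trans _ _ (\sum_(i <- r) (e `^ p * (u i `^ p * \1_(A i) w))%:E)%E).
  rewrite sumEFin -mulr_sumr lee_fin -mulrA ler_wpM2l ?powR_ge0//.
  by apply: le_trans (Bf _ Bw); rewrite ler_wpM2l ?ltW.
apply: lee_sum => i _; rewrite indicE; have [/set_mem Aw|] := boolP (w \in A i); last first.
  by rewrite !mulr0 poweR_ge0.
rewrite mulr1 -powRM// -poweR_EFin; apply: gt0_ler_poweR; rewrite ?(ltW p0)//.
- by rewrite in_itv/= leey lee_fin mulr_ge0.
- by rewrite in_itv/= leey abse_ge0.
exact: ux.
Qed.

End Probability.

Lemma besov_space_level (R : realType) (d : nat) (s : R) (p q : \bar R)
    (a : J d -> R) (k : scale d) :
  (0 < q)%E -> besov_space s p q a ->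
  (lp_norm p (fun m => (a (k, m))%:E) < +oo)%E.
Proof.
move=> q0 aB; rewrite ltey; apply/eqP => xoo.
have := le_lt_trans (lp_norm_ge_entry _ _ k q0) aB.
by rewrite xoo gt0_muley ?lte_fin ?powR_gt0// ltxx.
Qed.

Section Transfer.
Context {R : realType} {disp : measure_display} {Omega : measurableType disp}.
Variable P : probability Omega R.

(** If the norm of u were infinite, every level n could be reached with
probability at least c / 2. *)
Lemma lp_norm_lty_ae (I : choiceType) (p : \bar R) (c e : R) (u : I -> R)
    (A : I -> set Omega) (x : I -> Omega -> \bar R) :
  (0 < p)%E -> 0 < c -> 0 < e ->
  (forall i, measurable (A i)) -> (forall i, c%:E <= P (A i))%E ->
  (forall i, 0 <= u i) ->
  (forall i w, A i w -> (e * u i)%:E <= `|x i w|)%E ->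
  {ae P, forall w, (lp_norm p (fun i => x i w) < +oo)%E} ->
  (lp_norm p (fun i => (u i)%:E) < +oo)%E.
Proof.
move=> p0 c0 e0 mA cA u0 ux xfin; rewrite ltNge leye_eq; apply/negP => /eqP uoo.
have c20 : 0 < c / 2 by rewrite divr_gt0.
pose C := e * (c / 2) `^ rinv p.
have C0 : 0 < C by rewrite mulr_gt0 ?powR_gt0.
have /choice[B BP] : forall n : nat, exists B : set Omega,
    [/\ measurable B, ((c / 2)%:E <= P B)%E & forall w, B w ->
      (n%:R%:E <= lp_norm p (fun i => x i w))%E].
  move=> n; have yn : 0 <= n%:R / C :> R by rewrite divr_ge0// ltW.
  have := @lp_norm_ge_prob _ _ _ P I p c e (n%:R / C) u A x
    p0 c0 (ltW e0) mA cA u0 ux yn.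
  rewrite uoo ltry => /(_ isT)[B [mB cB xB]]; exists B; split => // w /xB.
  by rewrite -/C mulrC divfK ?gt_eqF.
apply: (@ae_finite_unlikely _ _ _ P _ _ B c20 _ _ _ xfin).
- by move=> n; have [] := BP n.
- by move=> n; have [] := BP n.
- by move=> n w; have [_ _] := BP n; exact.
Qed.

(** The inner norms x k of the random sequence play the role of the entries for
the outer norm: they are at least a multiple of the inner norms v k of the
weights on events B k whose probabilities are bounded below uniformly in k. *)
Lemma besov_space_ae (d : nat) (s : R) (p q : \bar R) (c e : R) (u : J d -> R)
    (A : J d -> set Omega) (a : J d -> Omega -> R) :
  (0 < p)%E -> (0 < q)%E -> 0 < c -> 0 < e ->
  (forall i, measurable (A i)) -> (forall i, c%:E <= P (A i))%E ->
  (forall i, 0 < u i) -> (forall i w, A i w -> e * u i <= `|a i w|) ->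
  {ae P, forall w, besov_space s p q (fun i => a i w)} ->
  besov_space s p q u.
Proof.
move=> p0 q0 c0 e0 mA cA u0 ua a_fin.
pose h (k : scale d) : R := 2 `^ ((level k)%:R * (s + d%:R / 2 - d%:R * rinv p)).
have h0 k : 0 < h k by rewrite powR_gt0.
pose x k w := lp_norm p (fun m => (a (k, m) w)%:E).
have ux k m w : A (k, m) w -> ((e * u (k, m))%:E <= `|(a (k, m) w)%:E|)%E.
  by move=> Aw; rewrite abse_EFin lee_fin; exact: ua.
have x_fin k : {ae P, forall w, (x k w < +oo)%E}.
  by apply: filterS a_fin => w; exact: besov_space_level.
have uk0 k m : 0 <= u (k, m) by exact: ltW.
have v_fin k : (lp_norm p (fun m => (u (k, m))%:E) < +oo)%E.
  exact: (@lp_norm_lty_ae _ p c e _ (fun m => A (k, m)) _ p0 c0 e0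
    (fun=> mA _) (fun=> cA _) (uk0 k) (ux k) (x_fin k)).
pose v k := fine (lp_norm p (fun m => (u (k, m))%:E)).
have v0E k : 0 < v k /\ lp_norm p (fun m => (u (k, m))%:E) = (v k)%:E.
  have u_le := lp_norm_ge_entry p (fun m => (u (k, m))%:E) [ffun=> 0] p0.
  have lp0 : (0 < lp_norm p (fun m => (u (k, m))%:E))%E.
    by apply: lt_le_trans u_le; rewrite abse_EFin lte_fin gtr0_norm.
  have E : lp_norm p (fun m => (u (k, m))%:E) = (v k)%:E.
    by rewrite fineK// ge0_fin_numE ?ltW.
  by split=> //; rewrite -lte_fin -E.
have v0 k := (v0E k).1; have vE k := (v0E k).2.
(* The final factor 1/2 makes the level v k / 2 lie strictly below v k. *)
pose C := e * (c / 2) `^ rinv p / 2.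
have c20 : 0 < c / 2 by rewrite divr_gt0.
have C0 : 0 < C by rewrite divr_gt0// mulr_gt0// powR_gt0.
have /choice[B BP] : forall k, exists B : set Omega,
    [/\ measurable B, ((c / 2)%:E <= P B)%E & forall w, B w ->
      ((C * v k)%:E <= x k w)%E].
  move=> k; have y0 : 0 <= v k / 2 by rewrite divr_ge0// ltW.
  have := @lp_norm_ge_prob _ _ _ P _ p c e _ _ (fun m => A (k, m)) _
    p0 c0 (ltW e0) (fun=> mA _) (fun=> cA _) (uk0 k) (ux k) y0.
  rewrite vE lte_fin => /(_ _)[|B [mB cB xB]]; first by have := v0 k; lra.
  exists B; split => // w /xB; rewrite -/(x k w).
  by congr (_%:E <= _)%E; rewrite /C; field.
rewrite /besov_space/= /besov_norm.
under [X in lp_norm q X]funext => k do rewrite vE -EFinM.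
apply: (@lp_norm_lty_ae _ q (c / 2) C _ B (fun k w => (h k)%:E * x k w)%E) => //.
- by move=> k; have [] := BP k.
- by move=> k; have [] := BP k.
- by move=> k; rewrite mulr_ge0// ltW.
move=> k w Bw; have [_ _ /(_ w Bw) xB] := BP k.
rewrite -/(h k) mulrCA EFinM.
apply: le_trans (lee_abs _); apply: lee_wpmul2l => //.
by rewrite lee_fin ltW.
Qed.

End Transfer.

(** * The weights *)

Definition lattice_shell (d N : nat) : seq (Zlattice d) :=
  [seq [ffun i => Posz (N + f i)] | f : {ffun 'I_d -> 'I_N}].

Lemma lattice_shellP d : (0 < d)%N -> shells d (@supnorm d) (lattice_shell d).
Proof.
move=> d0 N N0; split.
- rewrite map_inj_uniq ?enum_uniq// => f g /ffunP fg; apply/ffunP => i.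
  have := fg i; rewrite !ffunE => -[] /addnI; exact: val_inj.
- by rewrite size_map -cardE card_ffun !card_ord.
move=> m /mapP[f _ ->]; apply/andP; split.
  have := @leq_bigmax 'I_d (fun i => `|[ffun i => Posz (N + f i)] i|%N) (Ordinal d0).
  apply: leq_trans; rewrite ffunE/=; exact: leq_addr.
rewrite /supnorm -addnn -(prednK (ltn_addr N N0)) ltnS.
apply/bigmax_leqP => i _; rewrite ffunE absz_nat -ltnS (prednK (ltn_addr N N0)).
by rewrite ltn_add2l.
Qed.

Lemma level_type_top (d j : nat) : (0 < d)%N ->
  (j, [ffun=> if j == 0%N then F else M] : symbols d).2 \in
    level_types d (j, [ffun=> if j == 0%N then F else M] : symbols d).1.
Proof.
move=> d0; rewrite /level_types/=; case: (j == 0%N); rewrite !inE//.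
by apply/eqP => /ffunP/(_ (Ordinal d0)); rewrite !ffunE.
Qed.

(** One pair (j, t) for each level j; sums over types are bounded below by a
single term. *)
Definition top_scale (d : nat) (d0 : (0 < d)%N) (j : nat) : scale d :=
  exist _ (j, [ffun=> if j == 0%N then F else M]) (level_type_top d j d0).

Lemma level_shellP (d : nat) (d0 : (0 < d)%N) :
  shells 1 (@level d) (fun N => [seq top_scale d d0 j | j <- iota N N]).
Proof.
move=> N N0; split.
- rewrite map_inj_uniq ?iota_uniq// => i j.
  by move=> /(congr1 (@level d)).
- by rewrite size_map size_iota expn1.
by move=> _ /mapP[j + ->]; rewrite mem_iota addnn.
Qed.

Section Deterministic.
Context {R : realType}.

Lemma powR_ge_comparable (K x y b : R) : 0 < K -> 0 < y -> y <= K * x ->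
  x <= K * y -> K `^ (- `|b|) * y `^ b <= x `^ b.
Proof.
move=> K0 y0 yx xy; have x0 : 0 < x by rewrite -(pmulr_rgt0 _ K0) (lt_le_trans y0).
have [Kx0 Ky0] : 0 <= K * x /\ 0 <= K * y by rewrite !mulr_ge0 ?ltW.
have [b0|/ltW b0] := leP 0 b.
  rewrite ger0_norm// powRN ler_pdivrMl ?powR_gt0// -powRM ?(ltW K0) ?(ltW x0)//.
  by apply: ge0_ler_powR; rewrite ?nnegrE ?(ltW y0).
rewrite ler0_norm// opprK -powRM ?(ltW K0) ?(ltW y0)//.
rewrite -[b]opprK !(powRN _ (- b)) lef_pV2 ?posrE ?powR_gt0 ?mulr_gt0//.
by apply: ge0_ler_powR; rewrite ?nnegrE ?oppr_ge0 ?(ltW x0).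
Qed.

(** With z = j sigma / a, 2^(j sigma) = (2^z)^a, and 2^z is at least the affine
function 1 + z ln 2 of j. *)
Lemma exp_ge_poly (sigma a : R) : 0 < sigma -> 0 < a ->
  exists2 k : R, 0 < k & forall j : nat,
    k * (1 + j%:R) `^ a <= 2 `^ (j%:R * sigma).
Proof.
move=> sigma0 a0; have ln20 : 0 < ln 2 :> R by rewrite ln_gt0// ltr1n.
pose t := sigma * ln 2 / a.
have t0 : 0 < t by rewrite divr_gt0// mulr_gt0.
have m0 : 0 < Num.min 1 t by rewrite lt_min ltr01.
exists (Num.min 1 t `^ a); first by rewrite powR_gt0.
move=> j; have j0 : 0 <= j%:R :> R by [].
have -> : j%:R * sigma = j%:R * sigma / a * a by rewrite divfK ?gt_eqF.
have jp : 0 <= 1 + j%:R :> R by rewrite addr_ge0.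
rewrite powRrM -powRM ?(ltW m0)//.
apply: ge0_ler_powR; rewrite ?nnegrE ?powR_ge0 ?mulr_ge0 ?(ltW m0) ?(ltW a0)//.
rewrite /powR pnatr_eq0/=.
have -> : j%:R * sigma / a * ln 2 = j%:R * t by rewrite /t; field; rewrite gt_eqF.
apply: le_trans (expR_ge1Dx _).
have m1 : Num.min 1 t <= 1 by rewrite ge_min lexx.
have mt : Num.min 1 t <= t by rewrite ge_min lexx orbT.
by rewrite mulrDr mulr1 lerD// mulrC ler_wpM2l.
Qed.

(** The exponent gamma governs level 0 and beta all levels j >= 1, so levels 0 and
1 reveal their conditions. For the outer norm, on the shell with N = 2^j the
factor 1 + |m| / 2^j stays in [1, 3], so the inner norm at level j is at least a
multiple of 2^(j alpha) (j + 1)^theta 2^(j d / p). *)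
Lemma propertyA_of_weight (d : nat) (d0 : (0 < d)%N)
    (s alpha beta gamma theta : R) (p q : \bar R) : (0 < p)%E -> (0 < q)%E ->
  besov_space s p q (fun i : J d =>
    prior_weight alpha beta gamma theta (level i.1) i.2) ->
  propertyA d s p q alpha beta gamma theta.
Proof.
move=> p0 q0 uB.
have gammaP : if p == +oo%E then gamma <= 0 else gamma < - (d%:R * rinv p).
  have := besov_space_level _ _ _ _ _ _ (top_scale d d0 0) q0 uB.
  apply: (lp_norm_growth p d _ _ _ 1 gamma p0 (lattice_shellP d d0)) => // N _ m _.
  rewrite abse_EFin lee_fin.
  rewrite /prior_weight /level /= mul0r powRr0 powR1 !mul1r expr0 divr1.
  by rewrite mulr1 subrKC ler_norm.
have betaP : if p == +oo%E then beta <= 0 else beta < - (d%:R * rinv p).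
  have := besov_space_level _ _ _ _ _ _ (top_scale d d0 1) q0 uB.
  apply: (lp_norm_growth p d _ _ _
    (2 `^ (1 * alpha) * 2 `^ theta * 2 `^ (- `|beta|)) beta p0
    (lattice_shellP d d0)) => [|N _ m _].
    by rewrite !mulr_gt0 ?powR_gt0.
  rewrite abse_EFin lee_fin; apply: le_trans (ler_norm _).
  rewrite /prior_weight /level /= mulr0 addr0 expr1 -mulrA.
  rewrite ler_wpM2l ?mulr_ge0 ?powR_ge0//.
  have m0 : 0 <= (supnorm m)%:R :> R by [].
  by apply: powR_ge_comparable => //; lra.
pose sigma := s + d%:R / 2 + alpha.
pose K : R := 3 `^ (- `|beta|).
have K0 : 0 < K by rewrite powR_gt0.
(* The shells of the levels start at N >= 1, so level 0, whose weights involve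
   gamma instead of beta, is never compared. *)
have outer delta k : 0 < k -> (forall j : nat, (0 < j)%N ->
    k * (1 + j%:R) `^ delta <= K * (2 `^ (j%:R * sigma) * (1 + j%:R) `^ theta)) ->
    if q == +oo%E then delta <= 0 else delta < - rinv q.
  move=> k0 kj; have := uB; rewrite -[rinv q]mul1r.
  apply: (lp_norm_growth q 1 _ _ _ k delta q0 (level_shellP d d0)) => //.
  move=> N N0 _ /mapP[j + ->]; rewrite mem_iota => /andP[Nj _].
  have j0 : (0 < j)%N by exact: leq_trans N0 Nj.
  have -> : level (top_scale d d0 j) = j by [].
  have J0 : (0 < 2 ^ j)%N by rewrite expn_gt0.
  have [ushell szshell rk] := lattice_shellP d d0 _ J0.
  pose h : R := 2 `^ (j%:R * (s + d%:R / 2 - d%:R * rinv p)).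
  pose b : R := 2 `^ (j%:R * alpha) * (1 + j%:R) `^ theta * K.
  have b0 : 0 <= b by rewrite !mulr_ge0 ?powR_ge0 ?(ltW K0).
  have shell0 : lattice_shell d (2 ^ j) != [::].
    by rewrite -size_eq0 szshell expn_eq0 negb_and expn_eq0.
  have bnd := lp_norm_ge_seq p (fun m : Zlattice d =>
    (prior_weight alpha beta gamma theta j m)%:E) _ b p0 ushell shell0 b0.
  apply: le_trans (lee_abs _).
  apply: (@le_trans _ _ (h%:E * (b * ((2 ^ j) ^ d)%N%:R `^ rinv p)%:E)%E).
    rewrite -EFinM lee_fin; apply: le_trans (kj j j0) _.
    rewrite natrX natrX -!powR_mulrn// -!powRrM.
    have E : 2 `^ (j%:R * sigma) =
        h * 2 `^ (j%:R * alpha) * 2 `^ (j%:R * (d%:R * rinv p)) :> R.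
      rewrite -!powRD ?pnatr_eq0 ?implybT//; congr (_ `^ _); rewrite /sigma; ring.
    by rewrite E /b le_eqVlt; apply/orP; left; apply/eqP; ring.
  apply: lee_wpmul2l; first by rewrite lee_fin powR_ge0.
  rewrite -szshell; apply: bnd => m mshell; rewrite abse_EFin lee_fin.
  apply: le_trans (ler_norm _); rewrite /b /prior_weight.
  rewrite -(natrD _ 1) add1n gtn_eqF// mulr0 addr0 ler_wpM2l ?mulr_ge0 ?powR_ge0//.
  have := powR_ge_comparable 3 (1 + (supnorm m)%:R / 2 ^+ j) 1 beta.
  rewrite powR1 !mulr1; apply => //.
    have : 0 <= (supnorm m)%:R / 2 ^+ j :> R by rewrite divr_ge0.
    by move: (_ / _) => z; lra.
  have : (supnorm m)%:R / 2 ^+ j <= 2 :> R.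
    rewrite ler_pdivrMr ?exprn_gt0// -natrX -natrM ler_nat mul2n.
    by have /andP[_ /ltnW] := rk _ mshell.
  by move: (_ / _) => z; lra.
have [sigma0|sigma0] := ltP sigma 0; first by left.
(* For sigma > 0, an exponential of j absorbs (1 + j)^theta and leaves a factor
   1 + j. *)
have sigmaE : sigma = 0.
  apply/eqP; rewrite eq_le sigma0 andbT leNgt; apply/negP => sigma_gt0.
  have a0 : 0 < `|1 - theta| + 1 by rewrite ltr_wpDl.
  have [k k0 kP] := exp_ge_poly sigma _ sigma_gt0 a0.
  have := outer 1 (K * k) (mulr_gt0 K0 k0); have rinv0 : 0 <= rinv q.
    by rewrite /rinv fine_ge0// inve_ge0 ltW.
  suff H j : K * k * (1 + j%:R) `^ 1 <= K * (2 `^ (j%:R * sigma) * (1 + j%:R) `^ theta).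
    by move=> /(_ (fun j _ => H j)); case: ifP => _; lra.
  have j1 : 1 <= 1 + j%:R :> R by rewrite lerDl.
  have j0 : 0 < 1 + j%:R :> R by rewrite (lt_le_trans ltr01).
  rewrite -mulrA ler_wpM2l ?(ltW K0)// -[X in _ `^ X](subrK theta).
  rewrite powRD ?(gt_eqF j0) ?implybT// mulrA ler_wpM2r ?powR_ge0//.
  apply: le_trans (kP j); rewrite ler_wpM2l ?(ltW k0)//; apply: ler_powR => //.
  by rewrite (le_trans (ler_norm _))// lerDl.
right; split => //; apply: (outer theta K K0) => j _.
by rewrite sigmaE mulr0 powRr0 mul1r.
Qed.

End Deterministic.

(** * The prior *)

Lemma measurable_norm_ge (R : realType) (e : R) :
  measurable [set x : R | e <= `|x|].
Proof.
have -> : [set x : R | e <= `|x|] = Num.norm @^-1` `[e, +oo[.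
  by apply/seteqP; split => x /=; rewrite in_itv/= andbT.
by rewrite -[_ @^-1` _]setTI; apply: normr_measurable.
Qed.

(** {X <> 0} is the union of the events |X| >= 1 / (n + 1), which cannot all be
negligible. *)
Lemma norm_ge_prob_gt0 (R : realType) (disp : measure_display)
    (Omega : measurableType disp) (P : probability Omega R) (X : {RV P >-> R}) :
  (0 < P [set w | X w != 0%R])%E ->
  exists e c : R, [/\ 0 < e, 0 < c & c%:E = P (X @^-1` [set x | e <= `|x|])].
Proof.
move=> X0; pose E n := X @^-1` [set x : R | n.+1%:R^-1 <= `|x|].
have mE n : measurable (E n).
  rewrite -[E n]setTI; apply: (measurable_funPT X) => //.
  exact: measurable_norm_ge.
have [n En] : exists n, (0 < P (E n))%E.
  apply: contrapT => /forallNP allE; move: X0; apply/negP; rewrite -leNgt.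
  have UE0 : P.-negligible (\bigcup_n E n).
    apply: negligible_bigcup => n; apply/negligibleP => //.
    by apply/eqP; rewrite -measure_le0 leNgt; apply/negP/allE.
  have [N [mN N0 UN]] := UE0; rewrite -N0; apply: le_measure; rewrite ?inE//.
    have -> : [set w | X w != 0%R] = X @^-1` [set~ 0].
      by apply/seteqP; split => w /eqP.
    rewrite -[_ @^-1` _]setTI.
    by apply: (measurable_funPT X) => //; apply: measurableC.
  apply: subset_trans UN => w /= Xw; exists (Num.truncn `|X w|^-1) => //=.
  rewrite /E/= invf_ple ?posrE ?normr_gt0//.
  by rewrite ltW// truncnS_gt.
exists n.+1%:R^-1, (fine (P (E n))); split=> //.
- by rewrite fine_gt0// En ltey_eq fin_num_measure.
- by rewrite fineK// fin_num_measure.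
Qed.

Theorem theorem4p1 (R : realType) (d : nat) (d_gt0 : (0 < d)%N)
    (s alpha beta gamma theta : R) (p q : \bar R)
    (p_gt0 : (0 < p)%E) (q_gt0 : (0 < q)%E)
    (disp disp' : measure_display)
    (Omega : measurableType disp) (P : probability Omega R)
    (Omega' : measurableType disp') (P' : probability Omega' R)
    (X : {RV P' >-> R}) (a : J d -> Omega -> R)
    (a_prior : besov_sequence_prior alpha beta gamma theta P X a)
    (X_neq0 : (0 < P' [set w | X w != 0%R])%E)
    (a_besov : {ae P, forall w, besov_space s p q (fun i => a i w)}) :
  propertyA d s p q alpha beta gamma theta.
Proof.
have [xi [_ xiX aE]] := a_prior.
have [e [c [e0 c0 cE]]] := norm_ge_prob_gt0 _ _ _ _ X X_neq0.
have mB : measurable [set x : R | e <= `|x|] by exact: measurable_norm_ge.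
apply: (propertyA_of_weight _ d_gt0) => //.
pose z (i : J d) := (level i.1, ftype i.1, i.2).
apply: (besov_space_ae P d s p q c e _
  (fun i => xi (z i) @^-1` [set x | e <= `|x|]) _ p_gt0 q_gt0 c0 e0 _ _ _ _ a_besov).
- by move=> i; rewrite -[_ @^-1` _]setTI; exact: (measurable_funPT (xi (z i))).
- by move=> i; rewrite cE; have := xiX (z i) _ mB; rewrite /distribution /pushforward => ->.
- by move=> [k m]; rewrite /prior_weight !mulr_gt0 ?powR_gt0// ltr_pwDl// divr_ge0.
move=> [k m] w /= ew; rewrite aE normrM mulrC ger0_norm; last first.
  by rewrite /prior_weight !mulr_ge0 ?powR_ge0.
by rewrite ler_wpM2l// /prior_weight !mulr_ge0 ?powR_ge0.
Qed.
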